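(* Let $d\ge 1$ and let $X$ be a $\mathbb{Z}^d$-shift of finite type such that: (i) for every $w\in L(X)$ there exists $\mu\in\mathcal{M}(X)$ with $\mu([w])>0$; and (ii) there exists $N\in\mathbb{N}$ such that for every finite $S\subset\mathbb{Z}^d$ and all $w,w'\in L_S(X)$, there exist $n\le N$ and patterns $w=w_1,w_2,\ldots,w_n=w'$ in $L_S(X)$ such that for each $1\le i<n$ there exist homoclinic points $x,x'\in X$ with $x(S)=w_i$ and $x'(S)=w_{i+1}$. Then $X$ has topologically completely positive entropy (TCPE).
   Context: A $\mathbb{Z}^d$ topological dynamical system $(X,T_v)$ is a compact metric space $X$ with a $\mathbb{Z}^d$-action $\{T_v\}_{v\in\mathbb{Z}^d}$ by homeomorphisms of $X$. For a finite set $A$ (an alphabet), $A^{\mathbb{Z}^d}$ carries the product of discrete topologies and the shift action $(\sigma_t x)(s)=x(s+t)$, $s,t\in\mathbb{Z}^d$. A $\mathbb{Z}^d$-subshift is a nonempty closed shift-invariant subset of some $A^{\mathbb{Z}^d}$, regarded as a topological dynamical system under $\sigma$. A pattern over $A$ with shape $S$ is an element of $A^S$, for a finite $S\subset\mathbb{Z}^d$; $x(S)$ denotes the restriction of $x$ to $S$. Patterns are identified up to translation when speaking of their appearing in a point. A $\mathbb{Z}^d$-shift of finite type (SFT) is a (nonempty) subshift consisting of all $x\in A^{\mathbb{Z}^d}$ in which no pattern from some fixed finite set of patterns appears. The language $L(X)$ is the set of all patterns appearing in points of $X$, and $L_S(X)=L(X)\cap A^S$. For $w\in L_S(X)$, $[w]=\{x\in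 X: x(S)=w\}$. $\mathcal{M}(X)$ is the set of shift-invariant Borel probability measures on $X$. Two points $x,x'\in X$ are homoclinic if $x(v)=x'(v)$ for all but finitely many $v\in\mathbb{Z}^d$. The topological entropy is $h(X,T_v)=\sup_{\mathcal{U}}\lim_{n\to\infty}\frac1{n^d}\log N\left(\bigvee_{v\in\{1,\ldots,n\}^d} T_v\mathcal{U}\right)$, where $\mathcal{U}$ ranges over open covers of $X$ and $N(\cdot)$ is the minimal cardinality of a subcover. A factor map $(X,T_v)\to(Y,S_v)$ is a continuous map $\phi:X\to Y$ with $\phi\circ T_v=S_v\circ\phi$ for all $v\in\mathbb{Z}^d$. $(X,T_v)$ has TCPE if for every surjective factor map from $(X,T_v)$ to a $\mathbb{Z}^d$ topological dynamical system $(Y,S_v)$, either $h(Y,S_v)>0$ or $|Y|=1$. *)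

(* Defs.v *)
From HB Require Import structures.
From mathcomp Require Import all_boot all_order all_algebra finmap.
From mathcomp Require Import all_classical all_reals all_analysis.
Import Order.TTheory GRing.Theory Num.Theory.
Import numFieldNormedType.Exports.

Set Implicit Arguments.
Unset Strict Implicit.
Unset Printing Implicit Defensive.

Local Open Scope classical_set_scope.
Local Open Scope ring_scope.

Definition Zd (d : nat) := 'rV[int]_d.

Section dynamics.
Context (R : realType) (d : nat).

(* The maps S v are homeomorphisms: the continuous inverse of S v is S (- v). *)
Definition is_tds (Y : metricType R) (S : Zd d -> Y -> Y) : Prop :=
  [/\ compact [set: Y],
      forall y, S 0 y = y,
      forall u v y, S (u + v) y = S u (S v y)
    & forall v, continuous (S v)].

Definition open_cover (Y : topologicalType) (U : set (set Y)) : Prop :=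
  (forall u, U u -> open u) /\ \bigcup_(u in U) u = setT.

Definition has_subcover (Y : Type) (U : set (set Y)) (n : nat) : Prop :=
  exists F : set (set Y),
    [/\ F `<=` U, \bigcup_(u in F) u = setT & (F #= `I_n)%card].

(* The least n such that U has a subcover with n elements; the default value 0
   is used only when U has no finite subcover, which does not happen for an
   open cover of a compact space. *)
Definition cover_number (Y : Type) (U : set (set Y)) : nat :=
  xget 0%N [set n | has_subcover U n /\
                    forall m, has_subcover U m -> (n <= m)%N].

Definition cover_join (I Y : Type) (V : set I) (U : I -> set (set Y)) :
    set (set Y) :=
  [set \bigcap_(v in V) u v | u in [set u : I -> set Y |
                                    forall v, V v -> U v (u v)]].

Definition box (n : nat) : set (Zd d) :=
  [set v | forall i, 1 <= v ord0 i <= n%:Z].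

Definition iterated_cover (Y : Type) (S : Zd d -> Y -> Y) (U : set (set Y))
    (n : nat) : set (set Y) :=
  cover_join (box n) (fun v => [set S v @` u | u in U]).

(* For an action on a compact space the limit exists, by subadditivity. *)
Definition cover_entropy (Y : Type) (S : Zd d -> Y -> Y) (U : set (set Y)) : R :=
  limn (fun n : nat =>
    ln (cover_number (iterated_cover S U n))%:R / (n ^ d)%:R : R).

Definition entropy (Y : topologicalType) (S : Zd d -> Y -> Y) : \bar R :=
  ereal_sup [set (cover_entropy S U)%:E | U in @open_cover Y].

Definition factor_map (X Y : topologicalType) (T : Zd d -> X -> X)
    (S : Zd d -> Y -> Y) (phi : X -> Y) : Prop :=
  continuous phi /\ forall v x, phi (T v x) = S v (phi x).

(* Only the topology of the source X matters, so no metric on it is fixed. *)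
Definition TCPE (X : topologicalType) (T : Zd d -> X -> X) : Prop :=
  forall (Y : metricType R) (S : Zd d -> Y -> Y), is_tds S ->
  forall phi : X -> Y, factor_map T S phi -> range phi = setT ->
  (0 < entropy S)%E \/ exists y : Y, [set: Y] = [set y].

End dynamics.

Section symbolic.
Context (d : nat) (A : finType).

Definition config := prod_topology (fun _ : Zd d => discrete_topology A).
HB.instance Definition _ := Topological.on config.

Definition shift (t : Zd d) (x : config) : config := fun s => x (s + t).

Definition restr (S : {fset Zd d}) (x : config) : {ffun S -> A} :=
  [ffun s : S => x (val s)].

Definition appears (S : {fset Zd d}) (w : {ffun S -> A}) (x : config) : Prop :=
  exists t, restr S (shift t x) = w.

Record subshift := Subshift {
  subshift_set :> set config;
  subshift_nonempty : subshift_set !=set0;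
  subshift_closed : closed subshift_set;
  subshift_shift : forall t x, subshift_set x -> subshift_set (shift t x) }.

Definition pattern := {S : {fset Zd d} & {ffun S -> A}}.

Definition is_SFT (X : subshift) : Prop :=
  exists2 F : set pattern, finite_set F &
    subshift_set X = [set x | forall p, F p -> ~ appears (tagged p) x].

Definition language (X : subshift) (S : {fset Zd d}) (w : {ffun S -> A}) : Prop :=
  exists2 x, subshift_set X x & appears w x.

Definition homoclinic (x y : config) : Prop := finite_set [set v | x v <> y v].

(* The subshift as a space of its own, with the induced topology. *)
Definition points (X : subshift) := set_type X.
HB.instance Definition _ (X : subshift) := Topological.on (points X).

Lemma points_inhabited (X : subshift) : exists x : points X, True.
Proof.
by case: (subshift_nonempty X) => x Xx; exists (exist _ x (mem_set Xx)).
Qed.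

(* The library requires measurable spaces to be pointed. *)
HB.instance Definition _ (X : subshift) :=
  isPointed.Build (points X) (sval (cid (points_inhabited X))).

Definition point_shift (X : subshift) (t : Zd d) (x : points X) : points X :=
  exist _ (shift t (val x))
    (mem_set (@subshift_shift X t (val x) (set_mem (valP x)))).

Definition borel (X : subshift) := g_sigma_algebraType (@open (points X)).

Definition cylinder (X : subshift) (S : {fset Zd d}) (w : {ffun S -> A}) :
    set (points X) :=
  [set x | restr S (val x) = w].

Definition shift_invariant (R : realType) (X : subshift)
    (mu : probability (borel X) R) : Prop :=
  forall (t : Zd d) (B : set (borel X)), measurable B ->
    mu (@point_shift X t @^-1` B) = mu B.

End symbolic.

Arguments point_shift {d A} X t x.
Arguments cylinder {d A} X {S} w.

(* Main.v *)
Require Import Defs.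
From mathcomp Require Import all_boot all_order all_algebra finmap.
From mathcomp Require Import all_classical all_reals all_analysis.
From mathcomp Require Import measurable_realfun zify.
Import Order.TTheory GRing.Theory Num.Theory numFieldNormedType.Exports.
Set Implicit Arguments.
Unset Strict Implicit.
Unset Printing Implicit Defensive.
Local Open Scope classical_set_scope.
Local Open Scope ring_scope.

(** A factor map [phi] from [X] onto a system [Y] whose entropy is not positive is
    shown to be constant, in two steps.

    First, [phi] identifies homoclinic points
    ([homoclinic_points_identified]). Since [X] is of finite type, the patterns of
    two homoclinic points [x] and [x'] on a large enough cube can be exchanged in
    any point of [X], independently at any places that keep the copies of the cube
    disjoint ([homoclinic_exchange]). An invariant measure that charges the pattern
    of [x] yields, by averaging over a sparse sublattice of a box, a point of [X]
    in which this pattern occurs at a positive proportion of the lattice points of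
    the box ([frequent_pattern]). If [phi x] and [phi x'] were distinct, the points
    obtained by exchanging subsets of these occurrences would need exponentially
    many members of an iterated cover of [Y] by two open sets, and the entropy of
    [Y] would be positive. This uses that the limit defining the entropy exists,
    which is Fekete's lemma for boxes ([growth_rate_cvg]), fed by the subadditivity
    of cover numbers ([coded_translates]).

    Second, any two patterns on a cube are linked by a chain of boundedly many
    homoclinic pairs. Along the chain [phi] is unchanged by each homoclinic pair
    and moves arbitrarily little between consecutive pairs, as these agree on a
    large cube and [phi] is uniformly continuous ([uniformly_local]). The number of
    moves is bounded independently of the cube, so [phi] takes the same value at
    all points ([chain_identified]). *)

(** * Cubes and agreement of configurations *)

Section Cubes.
Context (d : nat) (A : finType).

Definition cube (L : nat) : set (Zd d) :=
  [set v | forall i, (absz (v ord0 i) <= L)%N].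

Lemma cube_finite L : finite_set (cube L).
Proof.
pose g (f : {ffun 'I_d -> 'I_(L + L).+1}) : Zd d :=
  \row_i ((f i)%:Z - L%:Z).
apply: (@sub_finite_set _ _ (range g)); last exact/finite_image/finite_finset.
move=> v vL; exists [ffun i => inord (absz (v ord0 i + L%:Z))] => //.
apply/rowP => i; rewrite mxE ffunE inordK; move: (v ord0 i) (vL i) => z; lia.
Qed.

Definition fcube L : {fset Zd d} := fset_set (cube L).

Lemma in_fcube L v : (v \in fcube L) <-> cube L v.
Proof.
by rewrite in_fset_set; [split; [exact: set_mem|exact: mem_set]|exact: cube_finite].
Qed.

Lemma cubeD L L' u v : cube L u -> cube L' v -> cube (L + L') (u + v).
Proof.
move=> uL vL i; rewrite mxE.
by move: (u ord0 i) (v ord0 i) (uL i) (vL i) => a b; lia.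
Qed.

Lemma cubeN L v : cube L v -> cube L (- v).
Proof. by move=> vL i; rewrite mxE; move: (v ord0 i) (vL i) => a; lia. Qed.

Lemma cube_sub L L' : (L <= L')%N -> cube L `<=` cube L'.
Proof. by move=> LL v vL i; move: (vL i); lia. Qed.

(** This lets cubes stand for all finite windows: every finite-range condition
    below is stated on a cube of some radius. *)
Lemma cube_exhausts (D : set (Zd d)) :
  finite_set D -> exists L, D `<=` cube L.
Proof.
move=> fD; exists (\sum_(v <- fset_set D) \sum_(i < d) absz (v ord0 i))%N.
move=> v Dv i; have vD : v \in fset_set D by rewrite in_fset_set// mem_set.
rewrite (big_rem v)//= (bigD1 i)//=; lia.
Qed.

Definition agree (L : nat) (x y : config d A) :=
  forall s, cube L s -> x s = y s.

Lemma restr_fcube L (x y : config d A) :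
  restr (fcube L) x = restr (fcube L) y <-> agree L x y.
Proof.
split=> [xy s /in_fcube sL|xy].
  by have /ffunP/(_ [` sL]%fset) := xy; rewrite !ffunE.
by apply/ffunP => s; rewrite !ffunE; apply: xy; apply/in_fcube; exact: valP.
Qed.

Lemma agree_sub L L' x y : (L <= L')%N -> agree L' x y -> agree L x y.
Proof. by move=> LL xy s sL; apply: xy; exact: cube_sub sL. Qed.

Lemma agree_trans L x y z : agree L x y -> agree L y z -> agree L x z.
Proof. by move=> xy yz s sL; rewrite xy// yz. Qed.

End Cubes.

Section Topology.
Context (d : nat) (A : finType).

(** Cylinders over cubes form a neighbourhood basis: the filter that they
    generate at [x] converges to [x] coordinate by coordinate, so it refines the
    neighbourhood filter of the product topology. *)
Lemma config_nbhs (x : config d A) (U : set (config d A)) :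
  nbhs x U -> exists L, forall y, agree L x y -> U y.
Proof.
pose F := filter_from [set: nat] (fun L => [set y | agree L x y]).
have FF : ProperFilter F.
  apply: filter_from_proper; last by move=> L _; exists x.
  apply: filter_from_filter; first by exists 0%N.
  move=> L L' _ _; exists (maxn L L') => // y xy.
  by split; apply: agree_sub xy; [exact: leq_maxl|exact: leq_maxr].
suff Fx : F --> x by move=> /Fx[L _ LU]; exists L => y /LU.
apply/cvg_sup => s; apply/cvg_image.
  apply/seteqP; split=> // a _; exists (fun=> a) => //.
move=> V /nbhs_singleton Vx.
have [L sL] := cube_exhausts (finite_set1 s).
exists [set y | V (y s)].
  by exists L => // y /(_ s (sL _ erefl)) /= <-.
apply/seteqP; split=> [_ [y + <-]//|a Va]; exists (fun=> a) => //.
Qed.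

Lemma coord_continuous (s : Zd d) :
  continuous (fun x : config d A => x s : discrete_topology A).
Proof. exact: (@proj_continuous (Zd d) (fun=> discrete_topology A) s). Qed.

Lemma config_compact : compact [set: config d A].
Proof.
have := @tychonoff (Zd d) (fun=> discrete_topology A) (fun=> setT).
have -> : [set f : forall i : Zd d, discrete_topology A |
     forall i : Zd d, setT (f i)] = setT by apply/seteqP; split.
by apply=> _; apply: finite_compact; exact: (@finite_finset A).
Qed.

Context (X : subshift d A).

Lemma points_nbhs (x : points X) (U : set (points X)) :
  nbhs x U -> exists L, forall y : points X, agree L (val x) (val y) -> U y.
Proof.
move=> [_ [[W oW <-] Wx WU]].
have [|L LW] := @config_nbhs (val x) W; first exact: (open_nbhs_nbhs (conj oW Wx)).
by exists L => y /LW Wy; exact: WU.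
Qed.

Lemma val_continuous : continuous (val : points X -> config d A).
Proof. exact: (@initial_continuous _ _ (set_val : points X -> config d A)). Qed.

Lemma near_agree (x : points X) L :
  \forall y \near x, agree L (val x) (val y).
Proof.
have : nbhs x (\bigcap_(s in [set` fcube d L]) [set y : points X | val x s = val y s]).
  apply: filter_bigI => s _.
  have cs : continuous (fun y : points X => (val y) s : discrete_topology A).
    move=> y; exact: (@continuous_comp (points X) (config d A)
      (discrete_topology A) val (fun z => z s) y
      (@val_continuous y) (@coord_continuous s _)).
  have : nbhs x [set y : points X | val y s = val x s].
    exact: cs x _ (@discrete_set1 (discrete_topology A) (val x s)).
  by apply: filterS => y /= ->.
by apply: filterS => y xy s /in_fcube sL; exact: xy.
Qed.

Lemma points_compact : compact [set: points X].
Proof.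
move=> F FF _.
have cX : compact (subshift_set X).
  exact: subclosed_compact (@subshift_closed _ _ X) config_compact _.
have [|p [Xp clp]] := cX (val @ F).
  by apply: (@filterS _ F _ setT) filterT => /= y _; exact: set_valP.
exists (exist _ p (mem_set Xp)); split=> // U V FU [_ [[W oW <-] Wp WV]].
have [||y [[z Uz <-] Wy]] := clp (val @` U) W.
- by apply: (@filterS _ F _ U) => // z Uz; exists z.
- exact: (open_nbhs_nbhs (conj oW Wp)).
by exists z; split=> //; exact: WV.
Qed.

(** Uniform continuity on the compact space [points X], with agreement on a
    large cube in the role of closeness. At each point continuity gives a radius;
    that radius serves for all points of the corresponding cylinder, and
    compactness makes it uniform. *)
Lemma uniformly_local (R : realType) (Y : pseudoMetricType R)
    (phi : points X -> Y) (e : R) : continuous phi -> 0 < e ->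
  exists L, forall x y : points X,
    agree L (val x) (val y) -> ball (phi x) e (phi y).
Proof.
move=> cphi e0; have /compact_near_coveringP cov := points_compact.
have := cov nat \oo (fun L x => forall y : points X,
  agree L (val x) (val y) -> ball (phi x) e (phi y)) _.
case=> [x _|L _ LP]; last first.
  by exists L => x y; apply: (LP L) => //=.
have e20 : 0 < e / 2 by rewrite divr_gt0.
have /points_nbhs[L LP] : nbhs x (phi @^-1` ball (phi x) (e / 2)).
  by apply: cphi; exact: nbhsx_ballx.
exists ([set x' : points X | agree L (val x) (val x')], [set L' | (L <= L')%N]).
  by split; [exact: near_agree|exists L].
move=> [x' L'] [/= xx' LL'] y x'y; rewrite [e]splitr.
apply: (@ball_triangle _ _ (phi x)); first exact/ball_sym/LP.
by apply: LP; apply: agree_trans xx' _; exact: agree_sub x'y.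
Qed.

End Topology.

(** * Exchanging homoclinic patterns *)

Section Exchange.
Context (d : nat) (A : finType) (X : subshift d A).

(** The form in which the finite type hypothesis is used: membership in [X] can
    be tested through windows of one fixed radius [r], each compared with a window
    of a point of [X] that may depend on the place and be read at another place.
    Any [r] whose cube contains the shapes of all forbidden patterns works. *)
Lemma SFT_local : is_SFT X -> exists r, forall y : config d A,
  (forall t, exists u, exists2 x : config d A, subshift_set X x &
     forall s, cube r s -> y (s + t) = x (s + u)) -> subshift_set X y.
Proof.
move=> [F finF XF].
have [r rF] : exists r, forall p, F p -> forall s, s \in tag p -> cube r s.
  have [r rP] := @cube_exhausts d (\bigcup_(p in F) [set` tag p])
    (bigcup_finite finF (fun p _ => finite_fset (tag p))).
  by exists r => p Fp s sp; apply: rP; exists p.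
exists r => y loc; rewrite XF => p Fp [t yt].
have [u [x Xx yx]] := loc t.
move: Xx; rewrite XF => /(_ p Fp); apply; exists u.
rewrite -[RHS]yt; apply/ffunP => s; rewrite !ffunE /Defs.shift.
by rewrite yx//; apply: (rF p Fp); exact: valP.
Qed.

(** The translates [cube L - v], for [v] in [E], are pairwise disjoint. *)
Definition separated (L : nat) (E : set (Zd d)) := forall v v' q,
  E v -> E v' -> cube L (q + v) -> cube L (q + v') -> v = v'.

(** Homoclinic points supply patterns that can replace each other anywhere. If
    [x] and [x'] differ only inside a cube of radius [D], and [L] exceeds [D] by
    twice the radius [r] of [SFT_local], then in any [z] of [X] the copies of the
    [L]-cube of [x] at separated places can be overwritten, simultaneously, by
    the [L]-cube of [x']. A window of radius [r] that meets the changed part of a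
    copy lies inside that copy, where the new point looks like [x']; a window that
    meets no changed part sees [z] itself. *)
Lemma homoclinic_exchange (x x' : config d A) :
  is_SFT X -> subshift_set X x' -> homoclinic x x' ->
  exists L0, forall L, (L0 <= L)%N ->
  forall (z : config d A) (E : set (Zd d)), subshift_set X z -> separated L E ->
    (forall v, E v -> agree L x (Defs.shift (- v) z)) ->
  exists y, [/\ subshift_set X y, forall v, E v -> agree L x' (Defs.shift (- v) y)
    & forall q, (forall v, E v -> ~ cube L (q + v)) -> y q = z q].
Proof.
move=> /SFT_local[r Xloc] Xx' /cube_exhausts[D xx'].
exists (r + r + D)%N => L LD z E Xz sepE zE.
(* The copies that contain [q]; by separation there is at most one. *)
pose home q := [set v | E v /\ cube L (q + v)].
pose y : config d A := fun q =>
  if pselect (home q !=set0) then x' (q + xget 0 (home q)) else z q.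
have y_in v q : E v -> cube L (q + v) -> y q = x' (q + v).
  move=> Ev qv; rewrite /y; case: pselect => [h|]; last by case; exists v.
  have [Ew qw] : home q (xget 0 (home q)) by exact: xgetPex.
  by rewrite (sepE _ _ _ Ew Ev qw qv).
have y_out q : (forall v, E v -> ~ cube L (q + v)) -> y q = z q.
  by move=> nq; rewrite /y; case: pselect => [[v [Ev qv]]|//]; case: (nq v Ev qv).
exists y; split=> //; last first.
  by move=> v Ev s sL; rewrite /Defs.shift (y_in v) ?subrK.
apply: Xloc => t.
have [[v [s [Ev rs Ds]]]|far] := pselect (exists v s,
  [/\ E v, cube r s & cube D (s + t + v)]).
  exists (t + v), x' => // s' rs'; rewrite (y_in v)// ?addrA//.
  have -> : s' + t + v = (- s + s') + (s + t + v).
    by rewrite -(addrA s) addrACA addNr add0r addrA.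
  apply: cube_sub LD _ _; apply: cubeD => //.
  by apply: cubeD => //; exact: cubeN.
exists t, z => // s rs.
have [[v [Ev sv]]|no] := pselect (exists v, E v /\ cube L (s + t + v)).
  rewrite (y_in v)//; have := zE v Ev _ sv; rewrite /Defs.shift addrK => <-.
  apply: contrapT => ne; case: far; exists v, s; split=> //; exact/xx'/nesym.
by apply: y_out => v Ev sv; apply: no; exists v.
Qed.

End Exchange.

(** * Averaging events *)

Section Averaging.

(** First moment argument: the number of events that contain a random point has
    expectation at least [c * #|J|], so its maximal value is at least as large. *)
Lemma exists_many_hits (disp : measure_display) (T : measurableType disp)
    (R : realType) (P : probability T R) (J : finType) (B : J -> set T) (c : R) :
  (forall j, measurable (B j)) -> (forall j, c%:E <= P (B j))%E ->
  exists x, c * #|J|%:R <= #|[set j | `[< B j x >]]%SET|%:R.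
Proof.
move=> mB cB; pose hits x := #|[set j | `[< B j x >]]%SET|.
have ex_hits : exists n, `[< exists x, hits x = n >].
  by exists (hits point); apply/asboolP; exists point.
have ub_hits n : `[< exists x, hits x = n >] -> (n <= #|J|)%N.
  by move=> /asboolP[x <-]; exact: max_card.
case: (ex_maxnP ex_hits ub_hits) => m /asboolP[x xm] maxm.
exists x; rewrite -/(hits x) xm -lee_fin.
have -> : (c * #|J|%:R)%:E = (\sum_(j : J) c%:E)%E.
  by rewrite sumEFin sumr_const mulr_natr.
apply: (@le_trans _ _ (\sum_(j : J) P (B j))%E); first exact: lee_sum.
have -> : (\sum_(j : J) P (B j) =
    \int[P]_x (\sum_(j : J) (\1_(B j) x)%:E))%E.
  rewrite ge0_integral_sum//; last 1 first.
  - by move=> j; apply/measurable_EFinP; exact: measurable_indic.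
  by apply: eq_bigr => j _; rewrite integral_indic// setIT.
apply: (@le_trans _ _ (\int[P]_x (cst m%:R%:E) x)%E); last first.
  have P1 : P setT = 1%E := probability_setT P.
  by rewrite integral_cst// [X in (_ * X)%E](_ : _ = 1%E) ?mule1.
apply: ge0_le_integral => //.
- by move=> y _; apply: sume_ge0.
- apply: emeasurable_sum => j; apply/measurable_EFinP; exact: measurable_indic.
move=> y _; rewrite sumEFin lee_fin.
have -> : \sum_(j : J) \1_(B j) y = (hits y)%:R :> R.
  rewrite /hits -sum1_card natr_sum [RHS]big_mkcond/=; apply: eq_bigr => j _.
  by rewrite indicE inE; have -> : (y \in B j) = `[< B j y >] by []; case: asboolP.
by rewrite ler_nat; apply: maxm; apply/asboolP; exists y.
Qed.

End Averaging.

(** * Cover numbers as numbers of codes *)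

Section Codes.
Context (d : nat) (Y : Type) (S : Zd d -> Y -> Y) (U : set (set Y)).

(** Subcovers of an iterated cover, seen as families of itineraries: the code
    [i] selects a member [c i v] of [U] for each time [v] in [V], and every point
    follows one of these itineraries. The minimal number of codes is the cover
    number of the join over [V], and the index type [I] being an arbitrary finite
    type makes products and powers of covers easy to form. *)
Definition coded_by (V : set (Zd d)) (I : finType) : Prop :=
  exists c : I -> Zd d -> set Y, (forall i v, V v -> U (c i v)) /\
    forall y, exists i, forall v, V v -> c i v (S (- v) y).

Lemma coded_card V (I J : finType) : #|I| = #|J| -> coded_by V I -> coded_by V J.
Proof.
move=> IJ [c [cU cov]].
exists (fun j => c (enum_val (cast_ord (esym IJ) (enum_rank j)))); split=> [j v|y].
  exact: cU.
have [i iy] := cov y.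
exists (enum_val (cast_ord IJ (enum_rank i))) => v Vv.
by rewrite enum_valK cast_ordK enum_rankK; exact: iy.
Qed.

(** Points that no member of [U] can hold together at some time of [V] need
    pairwise different codes. *)
Lemma card_separated_le_codes V (I K : finType) (p : K -> Y) :
  coded_by V I ->
  (forall a b, a <> b -> exists2 v, V v &
     forall u, U u -> u (S (- v) (p a)) -> ~ u (S (- v) (p b))) ->
  (#|K| <= #|I|)%N.
Proof.
move=> [c [cU cov]] sep; have [f fP] := choice (fun a => cov (p a)).
apply: (@leq_card _ _ f) => a b fab; apply: contrapT => /sep[v Vv].
move=> /(_ _ (cU (f a) _ Vv) (fP _ _ Vv)); apply.
by rewrite fab; exact: fP.
Qed.

Hypothesis S0 : forall y, S 0 y = y.
Hypothesis SD : forall u v y, S (u + v) y = S u (S v y).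

Lemma in_translate v u y : (S v @` u) y <-> u (S (- v) y).
Proof.
split=> [[x ux <-]|uy]; first by rewrite -SD addNr S0.
by exists (S (- v) y) => //; rewrite -SD subrr S0.
Qed.

(** Subadditivity and invariance of cover numbers in one statement: if translates
    of [W] indexed by [J] cover [V], a code for [V] is a choice of one code for [W]
    in each translate. *)
Lemma coded_translates V W (I J : finType) (t : J -> Zd d) :
  (forall v, V v -> exists j, W (v - t j)) -> coded_by W I ->
  coded_by V {ffun J -> I}.
Proof.
move=> VW [c [cU cov]].
pose D f v : set Y := if pselect (exists j, W (v - t j)) is left ex
  then c (f (sval (cid ex))) (v - t (sval (cid ex))) else set0.
exists (fun f : {ffun J -> I} => D f); split=> [f v /VW ex|y].
  rewrite /D; case: pselect => // {}ex; apply: cU; exact: (svalP (cid ex)).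
have [i iP] := choice (fun j => cov (S (- t j) y)).
exists [ffun j => i j] => v /VW ex; rewrite /D; case: pselect => // {}ex.
rewrite ffunE; have := iP (sval (cid ex)) _ (svalP (cid ex)).
by rewrite -SD -opprD subrK.
Qed.

Local Notation joined V := (cover_join V (fun v => [set S v @` u | u in U])).

Lemma subcover_coded V n : has_subcover (joined V) n -> coded_by V 'I_n.
Proof.
move=> [F [FU Fcov]]; rewrite card_eq_sym => /card_set_bijP[f [fF _ Ff]].
have code (i : 'I_n) : exists c : Zd d -> set Y, (forall v, V v -> U (c v)) /\
    forall y, f i y -> forall v, V v -> c v (S (- v) y).
  have /FU[u uU ufi] : F (f i) by apply: fF; exact: ltn_ord.
  have : forall v, exists c, V v -> U c /\ u v = S v @` c.
    move=> v; have [Vv|] := pselect (V v); last by exists set0.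
    by have [c Uc cu] := uU v Vv; exists c.
  move=> /choice[c cP]; exists c; split=> [v /cP[]//|y].
  by rewrite -ufi => uy v Vv; apply/in_translate; have [_ <-] := cP v Vv; exact: uy.
have [c cP] := choice code; exists c; split=> [i|y]; first exact: (cP i).1.
have : setT y by []; rewrite -Fcov => -[u /Ff[k kn <-] fy].
by exists (Ordinal kn); exact: (cP (Ordinal kn)).2.
Qed.

Lemma coded_subcover V n : coded_by V 'I_n ->
  exists2 m, (m <= n)%N & has_subcover (joined V) m.
Proof.
move=> [c [cU cov]].
pose g (i : 'I_n) := \bigcap_(v in V) (S v @` c i v).
have [m Fm] := (finite_setP (range g)).1 (finite_image g (finite_finset (X := setT))).
exists m.
  rewrite -card_le_II; rewrite -(card_le_eql Fm).
  apply: card_le_trans (card_image_le _ _) _.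
  by rewrite (card_le_eqr (@card_II n)) card_lexx.
exists (range g); split=> //.
- move=> _ [i _ <-]; exists (fun v => S v @` c i v) => // v Vv.
  by exists (c i v) => //; exact: cU.
- apply/seteqP; split=> // y _; have [i iy] := cov y.
  by exists (g i); [exists i|move=> v Vv; apply/in_translate; exact: iy].
Qed.

(** The existence of some finite code is what makes [cover_number] a true minimum
    and not its default value. *)
Lemma cover_number_spec V (I : finType) : coded_by V I ->
  coded_by V 'I_(cover_number (joined V)) /\ (cover_number (joined V) <= #|I|)%N.
Proof.
move=> cI; have : exists n, has_subcover (joined V) n.
  have /coded_subcover[m _ ?] : coded_by V 'I_#|I|.
    by apply: coded_card cI; rewrite card_ord.
  by exists m.
move=> exn.
have /(xgetPex 0%N) : exists n, [set n | has_subcover (joined V) n /\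
    forall m, has_subcover (joined V) m -> (n <= m)%N] n.
  have exb : exists n, `[< has_subcover (joined V) n >].
    by case: exn => n; exists n; exact/asboolP.
  case: (ex_minnP exb) => m /asboolP mP mmin; exists m; split=> //.
  by move=> k kP; apply: mmin; exact/asboolP.
rewrite -/(cover_number _) => -[/subcover_coded sub minN]; split=> //.
have /coded_subcover[m mI /minN Nm] : coded_by V 'I_#|I|.
  by apply: coded_card cI; rewrite card_ord.
exact: leq_trans Nm mI.
Qed.

Lemma coded_box1 (I : finType) (u : I -> set Y) :
  (forall i, U (u i)) -> (forall y, exists i, u i y) ->
  coded_by (@box d 1) I.
Proof.
move=> uU cov; exists (fun i _ => u i); split=> // y.
have [i iy] := cov (S (- const_mx 1) y); exists i => v v1.
suff -> : v = const_mx 1 by [].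
by apply/rowP => k; rewrite mxE; apply/le_anti; rewrite andbC; exact: v1.
Qed.

Lemma coded_box_mul m n q (I : finType) : (m <= q * n)%N ->
  coded_by (@box d n) I -> coded_by (@box d m) {ffun {ffun 'I_d -> 'I_q} -> I}.
Proof.
move=> mqn; apply: (@coded_translates (@box d m) (@box d n) I {ffun 'I_d -> 'I_q}
  (fun f => \row_i (n * f i)%N%:Z)).
move=> v vm.
have : forall i, exists k : 'I_q, 1 <= v ord0 i - (n * k)%N%:Z <= n%:Z.
  move=> i; move: (v ord0 i) (vm i) => z zm.
  have n0 : (0 < n)%N by case: n mqn => [|//]; lia.
  (* Coordinates in [box] start at 1, hence the predecessor. *)
pose e := (absz z).-1.
  have eq : (e %/ n < q)%N by rewrite ltn_divLR//; lia.
  exists (Ordinal eq) => /=; have := divn_eq e n; have := ltn_pmod e n0.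
  rewrite mulnC; move: (n * _)%N (e %% n)%N => a b; lia.
move=> /fin_all_exists[f fP]; exists (finfun f) => i.
by rewrite !mxE ffunE; exact: fP.
Qed.

End Codes.

(** * Existence of the entropy limit *)

Section Fekete.
Context (R : realType) (d : nat) (N : nat -> nat).
Hypothesis N0 : forall n, (0 < N n)%N.
Hypothesis N_sub : forall m n q, (m <= q * n)%N -> (N m <= N n ^ (q ^ d))%N.

Let a n : R := ln (N n)%:R.
Let b n : R := a n / (n ^ d)%:R.

Lemma ln_count_ge0 n : 0 <= a n.
Proof. by rewrite ln_ge0// ler1n. Qed.

(** A box of side [m] is covered by [(m %/ n).+1 ^ d] boxes of side [n], whose
    total side is at most [m + n]. *)
Lemma growth_rate_le m n : (0 < m)%N -> (0 < n)%N ->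
  b m <= (1 + n%:R / m%:R) ^+ d * b n.
Proof.
move=> m0 n0; pose q := (m %/ n).+1.
have am : a m <= (q ^ d)%:R * a n.
  rewrite /a mulr_natl -lnXn ?ltr0n// -natrX ler_ln ?posrE ?ltr0n ?expn_gt0 ?N0//.
  by rewrite ler_nat; apply: N_sub; rewrite ltnW// ltn_ceil.
have mR : (m%:R : R) != 0 by rewrite pnatr_eq0 -lt0n.
have nR : (n%:R : R) != 0 by rewrite pnatr_eq0 -lt0n.
have -> : 1 + n%:R / m%:R = (m + n)%:R / m%:R :> R.
  by rewrite natrD mulrDl divff.
rewrite /b !natrX expr_div_n mulrAC ler_pM2r ?invr_gt0 ?exprn_gt0 ?ltr0n//.
apply: (le_trans am); rewrite mulrA mulrAC ler_wpM2r ?ln_count_ge0//.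
rewrite ler_pdivlMr ?exprn_gt0 ?ltr0n// -!natrX -natrM ler_nat -expnMn.
case: (d) => [//|k]; rewrite leq_exp2r// /q mulSn addnC leq_add2r.
by rewrite leq_trunc_div.
Qed.

(** Fekete's lemma for cubes in dimension [d]: the limit is the infimum [l] of
    the rates. If [b n < l + e], the bound of [growth_rate_le] tends to [b n] as [m]
    grows, so [b m < l + e] for all large [m]. *)
Lemma growth_rate_cvg : cvgn b.
Proof.
pose B := [set b n.+1 | n in [set: nat]].
have b_ge0 n : 0 <= b n by rewrite divr_ge0 ?ln_count_ge0.
have infB : has_inf B.
  by split; [exists (b 1), 0%N|exists 0 => _ [n _ <-]].
(* The index is shifted because the rate of the empty box is meaningless. *)
apply/cvg_ex; exists (inf B); rewrite -cvg_shiftS.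
apply/cvgrPdist_lt => e e0.
have [_ [n _ <-] ble] := inf_adherent e0 infB.
have cv : (1 + n.+1%:R * harmonic m) ^+ d * b n.+1 @[m --> \oo] --> b n.+1.
  have h1 : (1 + n.+1%:R * harmonic m : R) @[m --> \oo] --> (1 + n.+1%:R * 0 : R).
    by apply: cvgD; [exact: cvg_cst|apply: cvgM; [exact: cvg_cst|exact: cvg_harmonic]].
  have h2 := cvg_comp _ _ h1 (@exprn_continuous R d (1 + n.+1%:R * 0)).
  have := cvgM h2 (cvg_cst (b n.+1)).
  by rewrite mulr0 addr0 expr1n mul1r => h; exact: h.
have : \forall m \near \oo, (1 + n.+1%:R * harmonic m) ^+ d * b n.+1 < inf B + e.
  exact: (@cvgr_lt _ _ _ _ _ _ cv _ ble).
apply: filterS => m lt.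
have lb : inf B <= b m.+1 by apply: ge_inf; [exact: infB.2|exists m].
rewrite distrC ger0_norm ?subr_ge0// ltrBlDl.
by apply: le_lt_trans lt; exact: growth_rate_le.
Qed.

End Fekete.

(** * Positive entropy from many codes *)

(** Exponentially many codes, even along the multiples of one [M], give positive
    entropy: the limit that defines the entropy of [U] exists by Fekete's lemma, so
    it is determined by this subsequence. *)
Lemma entropy_gt0_of_codes (R : realType) (d : nat) (Y : topologicalType)
    (S : Zd d -> Y -> Y) (U : set (set Y)) (I : finType) (u : I -> set Y)
    (y0 : Y) (M : nat) (c : R) :
  (forall y, S 0 y = y) -> (forall v w y, S (v + w) y = S v (S w y)) ->
  open_cover U -> (forall i, U (u i)) -> (forall y, exists i, u i y) ->
  (0 < M)%N -> 0 < c ->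
  (forall k, exists a, c * (k ^ d)%:R <= a%:R /\
    forall n, coded_by S U (@box d (M * k)) 'I_n -> (2 ^ a <= n)%N) ->
  (0 < entropy R S)%E.
Proof.
move=> S0 SD oU uU ucov M0 c0 many.
pose N n := cover_number (iterated_cover S U n).
have coded1 := coded_box1 S uU ucov.
have spec n : coded_by S U (@box d n) 'I_(N n).
  have cn : coded_by S U (@box d n) {ffun {ffun 'I_d -> 'I_n} -> I}.
    by apply: (coded_box_mul SD _ coded1); rewrite muln1.
  exact: (cover_number_spec S0 SD cn).1.
have N0 n : (0 < N n)%N.
  have [c' [_ /(_ y0)[i _]]] := spec n; exact: leq_ltn_trans (ltn_ord i).
have Nsub m n q : (m <= q * n)%N -> (N m <= N n ^ (q ^ d))%N.
  move=> mqn; have := (cover_number_spec S0 SD (coded_box_mul SD mqn (spec n))).2.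
  by rewrite !card_ffun !card_ord.
have cvgb := growth_rate_cvg (R := R) N0 Nsub.
have ln2 : 0 < ln 2 :> R by rewrite ln_gt0// ltr1n.
have Md0 : 0 < (M ^ d)%:R :> R by rewrite ltr0n expn_gt0 M0.
pose kappa : R := c * ln 2 / (M ^ d)%:R.
have kappa0 : 0 < kappa by rewrite divr_gt0// mulr_gt0.
have lower k : kappa <= ln (N (M * k.+1)%N)%:R / ((M * k.+1) ^ d)%:R.
  have [a [ca /(_ _ (spec _)) aN]] := many k.+1.
  have kd0 : 0 < (k.+1 ^ d)%:R :> R by rewrite ltr0n expn_gt0.
  rewrite expnMn natrM ler_pdivlMr ?mulr_gt0// mulrA divfK ?gt_eqF//.
  apply: (@le_trans _ _ (a%:R * ln 2)).
    by rewrite mulrAC ler_wpM2r// ltW.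
  rewrite mulr_natl -lnXn// -natrX ler_ln ?posrE ?ltr0n ?expn_gt0//.
  by rewrite ler_nat.
have le_lim : kappa <= cover_entropy R S U.
  rewrite leNgt; apply/negP => lt.
  have [m _ mP] := (@cvgr_lt _ _ _ _ _ _ cvgb _ lt).
  have /mP : (m <= M * m.+1)%N by rewrite (leq_trans (leqnSn m))// leq_pmull.
  by rewrite /= ltNge lower.
apply: (@lt_le_trans _ _ (cover_entropy R S U)%:E).
  by rewrite lte_fin (lt_le_trans kappa0).
by apply: ereal_sup_ubound; exists U.
Qed.

Section Lattice.
Context (d L k : nat).

(** Points of the sublattice of mesh [2 L + 1], the least mesh that keeps the
    translates of [cube L] disjoint; the shift by one puts them in [box]. *)
Definition lattice_point (f : {ffun 'I_d -> 'I_k}) : Zd d :=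
  \row_i ((L + L).+1 * (f i).+1)%N%:Z.

Lemma lattice_point_box f : box ((L + L).+1 * k) (lattice_point f).
Proof.
move=> i; rewrite mxE; apply/andP; split; first by rewrite lez_nat muln_gt0.
by rewrite lez_nat leq_mul2l ltn_ord orbT.
Qed.

Lemma lattice_point_separated f g q :
  cube L (q + lattice_point f) -> cube L (q + lattice_point g) -> f = g.
Proof.
move=> qf qg; apply/ffunP => i; apply: val_inj.
have := qf i; have := qg i; rewrite !mxE.
move: (q ord0 i) => z; case: (ltngtP (f i) (g i)) => // fg.
  have := leq_mul2l (L + L).+1 (f i).+2 (g i).+1; rewrite ltnS fg orbT mulnS.
  move: (_ * _)%N (_ * (f i).+1)%N => a b; lia.
have := leq_mul2l (L + L).+1 (g i).+2 (f i).+1; rewrite ltnS fg orbT mulnS.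
move: (_ * _)%N (_ * (g i).+1)%N => a b; lia.
Qed.

End Lattice.

(** * Factors of zero entropy *)

Section ZeroEntropy.
Context (R : realType) (d : nat) (A : finType) (X : subshift d A).
Context (Y : metricType R) (S : Zd d -> Y -> Y) (phi : points X -> Y).
Hypothesis SFT_X : is_SFT X.
Hypothesis full_X : forall (T : {fset Zd d}) (w : {ffun T -> A}),
  language X w -> exists mu : probability (borel X) R,
    shift_invariant mu /\ (0 < mu (cylinder X w))%E.
Hypothesis S0 : forall y, S 0 y = y.
Hypothesis SD : forall u v y, S (u + v) y = S u (S v y).
Hypothesis phi_factor : factor_map (@point_shift d A X) S phi.

Lemma cylinder_open L (x : points X) :
  open (cylinder X (restr (fcube d L) (val x))).
Proof.
rewrite openE => y /restr_fcube yx; rewrite /interior.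
apply: filterS (near_agree y L) => z yz; apply/restr_fcube.
by apply: agree_trans yx => s sL; rewrite yz.
Qed.

(** An invariant measure charging the cylinder of the [L]-cube of [x] gives the same
    mass [c > 0] to its preimages under all shifts; hence for any
    finite family of places some point of [X] displays this pattern at a
    proportion at least [c] of them. Choosing the places on a lattice makes the
    occurrences separated from the start. *)
Lemma frequent_pattern L (x : points X) : exists2 c : R, 0 < c &
  forall (J : finType) (t : J -> Zd d), exists (z : points X) (O : {set J}),
    c * #|J|%:R <= #|O|%:R /\
    forall j, j \in O -> agree L (val x) (Defs.shift (t j) (val z)).
Proof.
set w := restr (fcube d L) (val x).
have [mu [inv mu0]] : exists mu : probability (borel X) R,
    shift_invariant mu /\ (0 < mu (cylinder X w))%E.
  apply: full_X; exists (val x); first exact: set_valP.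
  by exists 0; congr (restr _ _); apply/funext => s; rewrite /Defs.shift addr0.
have mw : measurable (cylinder X w : set (borel X)).
  by apply: sub_sigma_algebra; exact: cylinder_open.
have mufin : mu (cylinder X w) = (fine (mu (cylinder X w)))%:E.
  by rewrite fineK// fin_num_measure.
exists (fine (mu (cylinder X w))); first by rewrite -lte_fin -mufin.
move=> J t.
have mt j : measurable (@point_shift d A X (t j) @^-1` cylinder X w : set (borel X)).
  apply: sub_sigma_algebra; rewrite openE => y /restr_fcube yx; rewrite /interior.
  have [L' LL'] := @cube_exhausts d ((fun s => s + t j) @` cube L)
    (finite_image _ (@cube_finite d L)).
  apply: filterS (near_agree y L') => z yz; apply/restr_fcube.
  apply: agree_trans yx => s sL.
  by rewrite /= /Defs.shift yz//; apply: LL'; exists s.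
have mutj j : ((fine (mu (cylinder X w)))%:E <=
    mu (@point_shift d A X (t j) @^-1` cylinder X w))%E.
  by rewrite inv// -mufin.
have [z zP] := exists_many_hits mt mutj.
exists z, [set j | `[< (@point_shift d A X (t j) @^-1` cylinder X w) z >]]%SET.
split=> // j; rewrite inE => /asboolP /restr_fcube xz.
by move=> s sL; rewrite -xz.
Qed.

(** If [phi x] and [phi x'] are distinct, they have disjoint closed neighbourhoods
    [C false] and [C true]; take the cover of [Y] by their complements. A cube of
    [x], resp. [x'], is so large that it forces [phi] into [C false], resp.
    [C true]. In a point of [X] where the cube of [x] occurs at the places [Occ],
    exchange it for that of [x'] at the places of an arbitrary subset of [Occ]. The
    images of the [2 ^ #|Occ|] resulting points have pairwise different
    itineraries, and [#|Occ|] is proportional to the volume of the box. *)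
Lemma homoclinic_points_identified (x x' : points X) :
  ~ (0 < entropy R S)%E -> homoclinic (val x) (val x') -> phi x = phi x'.
Proof.
move=> ent0 xx'; apply: contrapT => /eqP ne; apply: ent0.
have [cphi phiS] := phi_factor.
have hY : hausdorff_space Y := @metric_hausdorff R Y.
rewrite ball_hausdorff in hY; have [[r s] /= /eqP rs0] := hY _ _ ne.
pose C (b : bool) := if b then closed_ball (phi x') (s%:num / 2)
  else closed_ball (phi x) (r%:num / 2).
have C01 y : C true y -> C false y -> False.
  move=> /subset_closure_half sy /subset_closure_half ry.
  suff : set0 y by [].
  by rewrite -rs0; split; [exact: ry|exact: sy].
have [L0 exch] := homoclinic_exchange SFT_X (set_valP x') xx'.
have near_C (z : points X) b : phi z = phi (if b then x' else x) ->
    exists L, forall y : points X, agree L (val z) (val y) -> C b (phi y).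
  move=> zb; apply: (@points_nbhs d A X z (phi @^-1` C b)); apply: cphi.
  rewrite zb /C; case: b {zb}.
    by apply: filterS (@subset_closed_ball _ _ _ _) (nbhsx_ballx _ _ _).
  by apply: filterS (@subset_closed_ball _ _ _ _) (nbhsx_ballx _ _ _).
have [L1 xC] := near_C x false erefl.
have [L2 x'C] := near_C x' true erefl.
pose L := maxn L0 (maxn L1 L2).
have xCL (y : points X) : agree L (val x) (val y) -> C false (phi y).
  by move=> /agree_sub xy; apply/xC/xy; rewrite /L !leq_max leqnn orbT.
have x'CL (y : points X) : agree L (val x') (val y) -> C true (phi y).
  by move=> /agree_sub xy; apply/x'C/xy; rewrite /L !leq_max leqnn !orbT.
have [c c0 freq] := frequent_pattern L x.
pose u b : set Y := ~` C b.
have u_cov y : exists b, u b y.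
  have [Cy|nCy] := pselect (C true y); last by exists true.
  by exists false => /(C01 _ Cy).
have uO b : open (u b).
  by rewrite openC; case: b => /=; exact: closed_closure.
apply: (@entropy_gt0_of_codes R d Y S (range u) bool u (phi x) (L + L).+1 c) => //.
  split; first by move=> _ [b _ <-].
  by apply/seteqP; split=> // y _; have [b uy] := u_cov y; exists (u b) => //; exists b.
move=> k.
pose pt := @lattice_point d L k.
have [z [Occ [cO zO]]] := freq _ (fun f => - pt f).
exists #|Occ|; split=> [|n cn]; first by rewrite card_ffun !card_ord in cO.
pose K := {E : {set {ffun 'I_d -> 'I_k}} | E \in powerset Occ}.
have -> : (2 ^ #|Occ|)%N = #|{: K}| by rewrite card_sig -card_powerset.
(* [E] is the set of places where the pattern of [x'] is inserted. *)
have exch_set (E : K) : exists y : points X, forall f, f \in Occ ->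
    C (f \in val E) (phi (point_shift X (- pt f) y)).
  have EO f : f \in val E -> f \in Occ.
    by have := valP E; rewrite powersetE => /fintype.subsetP; exact.
  have [| | | |y [Xy yE yz]] :=
    exch L _ (val z) [set v | exists2 f, f \in val E & v = pt f].
  - by rewrite /L leq_maxl.
  - exact: set_valP.
  - move=> _ _ q [f _ ->] [g _ ->] qf qg.
    by rewrite (lattice_point_separated qf qg).
  - by move=> _ [f fE ->]; exact/zO/EO.
  exists (exist _ y (mem_set Xy)) => f fO.
  have [fE|fE] := boolP (f \in val E).
    by apply: x'CL; apply: yE; exists f.
  apply: xCL => t tL; rewrite (zO _ fO t tL) /= /Defs.shift; apply/esym/yz.
  move=> _ [g gE ->] tg; move/negP: fE; apply.
  suff -> : f = g by [].
  by apply: (@lattice_point_separated d L k f g (t - pt f)) => //; rewrite subrK.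
have [p pP] := choice exch_set.
rewrite -[n]card_ord; apply: (card_separated_le_codes (p := phi \o p) cn).
move=> E F EF.
have [f fEF] : exists f, (f \in val E) != (f \in val F).
  apply: contrapT => same; apply: EF; apply/val_inj/setP => f.
  by apply/eqP; apply: contraT => ne'; case: same; exists f.
have sub (G : K) f' : f' \in val G -> f' \in Occ.
  by have := valP G; rewrite powersetE => /fintype.subsetP; exact.
have fO : f \in Occ.
  case: (boolP (f \in val E)) fEF => [/sub//|_].
  by case: (boolP (f \in val F)) => [/sub//|_].
exists (pt f); first exact: lattice_point_box.
move=> _ [b _ <-]; rewrite /u /= -!phiS => nE nF.
have bE : b != (f \in val E) by apply/eqP => bE; apply: nE; rewrite bE; exact: pP.
have bF : b != (f \in val F) by apply/eqP => bF; apply: nF; rewrite bF; exact: pP.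
by move: fEF bE bF; case: b {nE nF}; do 2 case: (_ \in _).
Qed.

End ZeroEntropy.

(** Two arbitrary points are joined by a chain which alternates between homoclinic
    jumps, invisible to [phi], and steps between points agreeing on a large cube,
    which move [phi] by less than [e / N.+1]. The bound [N] on the length of the
    chain does not depend on the cube, so the total displacement is less than [e];
    with [e] the distance of the two images this is absurd. *)
Lemma chain_identified (R : realType) (d : nat) (A : finType) (X : subshift d A)
    (Y : metricType R) (phi : points X -> Y) (N : nat) :
  continuous phi ->
  (forall x x' : points X, homoclinic (val x) (val x') -> phi x = phi x') ->
  (forall (S : {fset Zd d}) (w w' : {ffun S -> A}),
     language X w -> language X w' ->
     exists (n : nat) (u : nat -> {ffun S -> A}),
       [/\ (1 <= n <= N)%N, u 1%N = w, u n = w',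
           forall i, (1 <= i <= n)%N -> language X (u i)
         & forall i, (1 <= i < n)%N ->
             exists x x' : config d A,
               [/\ subshift_set X x, subshift_set X x', homoclinic x x',
                   restr S x = u i & restr S x' = u i.+1]]) ->
  forall x y, phi x = phi y.
Proof.
move=> cphi homo chain x y; apply: contrapT => /eqP; rewrite -mdist_gt0 => e0.
set e := mdist _ _ in e0.
suff : ball (phi x) e (phi y) by rewrite ballEmdist /= ltxx.
have e'0 : 0 < e / N.+1%:R by rewrite divr_gt0.
have [L LP] := uniformly_local cphi e'0.
have lang (z : points X) : language X (restr (fcube d L) (val z)).
  exists (val z); first exact: set_valP.
  by exists 0; congr (restr _ _); apply/funext => s; rewrite /Defs.shift addr0.
have [n [u [/andP[n1 nN] u1 un _ step]]] := chain _ _ _ (lang x) (lang y).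
have reach i : (i < n)%N -> forall z : points X,
    restr (fcube d L) (val z) = u i.+1 ->
    ball (phi x) (e / N.+1%:R *+ i.+1) (phi z).
  elim: i => [|i IH] iN z zu.
    by rewrite mulr1n; apply: LP; apply/restr_fcube; rewrite zu.
  have [v [v' [Xv Xv' vv' vu v'u]]] := step i.+1 iN.
  rewrite mulrSr; apply: (@ball_triangle _ _ (phi (exist _ v (mem_set Xv)))).
    by apply: IH => //; exact: ltnW.
  rewrite (homo _ (exist _ v' (mem_set Xv')))//; apply: LP.
  by apply/restr_fcube; rewrite v'u zu.
have := reach n.-1; rewrite prednK// leqnn => /(_ isT y); rewrite un => /(_ erefl).
apply: le_ball; rewrite -mulr_natr -mulrA ler_piMr ?ltW//.
by rewrite mulrC ltr_pdivrMr// mul1r ltr_nat.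
Qed.

(** * Topologically completely positive entropy *)

Theorem theorem1p4 (R : realType) (d : nat) (hd : (0 < d)%N) (A : finType)
  (X : subshift d A) (hX : is_SFT X)
  (hmeas : forall (S : {fset Zd d}) (w : {ffun S -> A}), language X w ->
     exists mu : probability (borel X) R,
       shift_invariant mu /\ (0 < mu (cylinder X w))%E)
  (hexch : exists N : nat,
     forall (S : {fset Zd d}) (w w' : {ffun S -> A}),
       language X w -> language X w' ->
       exists (n : nat) (u : nat -> {ffun S -> A}),
         [/\ (1 <= n <= N)%N, u 1%N = w, u n = w',
             forall i, (1 <= i <= n)%N -> language X (u i)
           & forall i, (1 <= i < n)%N ->
               exists x x' : config d A,
                 [/\ subshift_set X x, subshift_set X x', homoclinic x x',
                     restr S x = u i & restr S x' = u i.+1]]) :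
  TCPE R (point_shift X).
Proof.
move=> Y S [_ S0 SD _] phi phi_factor onto.
have [ent|ent0] := pselect (0 < entropy R S)%E; [by left|right].
have [N chain] := hexch.
have phi_cst : forall x y, phi x = phi y.
  apply: (chain_identified phi_factor.1 _ chain) => x x'.
  exact: (homoclinic_points_identified hX hmeas S0 SD phi_factor ent0).
exists (phi point); apply/seteqP; split=> // y _.
have : setT y by [].
by rewrite -onto => -[x _ <-]; exact: phi_cst.
Qed.
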